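(* Let $\mathcal{H}$ be a Hilbert space and let $\{f_n\}_{n\in\mathbb{N}}\subset\mathcal{H}$ be a Bessel-Schur sequence of unit vectors, i.e. $\|f_n\|=1$ for all $n\in\mathbb{N}$ and there exists a constant $B>0$ such that $$\sum_{k=0}^{\infty}|\langle f_j,f_k\rangle|\leq B\quad\text{for all } j\in\mathbb{N}.$$ Then $\{f_n\}_{n\in\mathbb{N}}$ can be partitioned into finitely many Riesz sequences: there exist an integer $r\geq 1$ and a partition $\mathbb{N}=I_1\cup\dots\cup I_r$ into pairwise disjoint nonempty sets such that, for every $p\in\{1,\dots,r\}$, $\{f_n\}_{n\in I_p}$ is a Riesz sequence.
   Context: $\mathbb{N}=\{0,1,2,\dots\}$. For $I\subset\mathbb{N}$, a family $\{f_n\}_{n\in I}$ in a Hilbert space $\mathcal{H}$ is called a Riesz sequence if there are constants $A,B'>0$ such that $$A\sum_k|c_k|^2\leq\Big\|\sum_k c_kf_k\Big\|^2\leq B'\sum_k|c_k|^2$$ for every finitely supported family of scalars $(c_k)_{k\in I}$. *)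

(* Defs.v *)
(* MathComp / MathComp-Analysis. *)
From HB Require Import structures.
From mathcomp Require Import all_boot all_order all_algebra sesquilinear.
From mathcomp Require Import complex.
From mathcomp Require Import all_classical all_reals all_analysis.

Set Implicit Arguments.
Unset Strict Implicit.
Unset Printing Implicit Defensive.

Import Order.TTheory GRing.Theory Num.Theory.
Import numFieldNormedType.Exports.

Local Open Scope classical_set_scope.
Local Open Scope ring_scope.

(* The scalar field of a Hilbert space together with its conjugation: the
   identity on the reals, complex conjugation on the complex numbers.
   The norm of a normed K-module takes its values in K; for K = R[i] the order
   is the partial one, in which 0 < A says that A is a positive real and
   a <= b says that b - a is a nonnegative real. *)
Inductive hilbert_scalars : forall K : numFieldType, (K -> K) -> Prop :=
| real_scalars (R : realType) : @hilbert_scalars R idfun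
| complex_scalars (R : realType) : @hilbert_scalars R[i] (@Num.conj R[i]).

Section Sequences.
Variables (K : numFieldType) (H : completeNormedModType K).

(* A `dot` form is Hermitian and positive definite, linear in its first
   argument. *)
Definition inner_product (theta : K -> K) (dot : {dot H for theta}) : Prop :=
  forall x : H, `|x| ^+ 2 = dot x x.

Definition Bessel_Schur (theta : K -> K) (dot : {dot H for theta})
    (f : nat -> H) : Prop :=
  exists2 B : K, 0 < B & forall j : nat,
    let s := series (fun k : nat => `|dot (f j) (f k)|) in
    cvgn s /\ limn s <= B.

(* The values of c outside I are irrelevant, and the sums over k \in I have
   finitely many nonzero terms. *)
Definition Riesz_sequence (I : set nat) (f : nat -> H) : Prop :=
  exists A B' : K, [/\ 0 < A, 0 < B' &
    forall c : nat -> K, finite_set [set k | I k /\ c k != 0] ->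
      A * (\sum_(k \in I) `|c k| ^+ 2) <= `|\sum_(k \in I) c k *: f k| ^+ 2
      /\ `|\sum_(k \in I) c k *: f k| ^+ 2
           <= B' * (\sum_(k \in I) `|c k| ^+ 2)].

End Sequences.

(* Main.v *)
(* Color the indices greedily with r colors, giving j the color p that minimizes
   the sum of |<f_j, f_k>| over the k < j of color p; by averaging this sum is at
   most B / r.  Within one color the strictly lower triangular part of the matrix
   |<f_j, f_k>| has row sums at most B / r and column sums at most B, so by the
   Schur test its norm is at most B / sqrt r.  For r >= 16 B^2 the off-diagonal
   part of the Gram matrix of a color class then has norm at most 1/2, whence
   Riesz bounds 1/2 and 3/2. *)
Require Import Defs.
From mathcomp Require Import all_boot all_order all_algebra sesquilinear.
From mathcomp Require Import complex ring.
From mathcomp Require Import all_classical all_reals all_analysis.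

Import Order.TTheory GRing.Theory Num.Theory.
Import numFieldNormedType.Exports.

Local Open Scope classical_set_scope.
Local Open Scope ring_scope.

(** Iterating [l |-> rcons l (F l)] from the empty list builds the list of the first [n] values;
    this lets a color depend on all earlier colors. *)
Lemma course_of_values (T : Type) (F : seq T -> T) :
  exists c : nat -> T, forall n, c n = F (mkseq c n).
Proof.
pose s n := iter n (fun l => rcons l (F l)) [::].
exists (F \o s) => n /=; congr F.
by elim: n => // n IHn; rewrite mkseqS -IHn.
Qed.

(** If all [S p] exceeded the mean bound, their sum would exceed [B]. Nonnegativity makes the values
    real, hence comparable in the partial order of [K]. *)
Lemma ex_le_mean (K : numFieldType) (r : nat) (S : 'I_r.+1 -> K) (B : K) :
  (forall p, 0 <= S p) -> \sum_p S p <= B -> exists p, S p <= B / r.+1%:R.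
Proof.
move=> S0 SB; apply: contrapT => /forallNP noS.
have B0 : 0 <= B by apply: le_trans SB; apply: sumr_ge0.
have Blt p : B / r.+1%:R < S p.
  have Br : B / r.+1%:R \is Num.real by rewrite realE divr_ge0.
  by rewrite real_ltNge//; [exact/negP/noS | rewrite realE S0].
have : \sum_(p < r.+1) B / r.+1%:R < \sum_p S p.
  by apply: ltr_sum => //; apply/hasP; exists ord0; rewrite // mem_index_enum.
rewrite sumr_const card_ord -[X in X < _]mulr_natr divfK ?pnatr_eq0//.
by move/lt_le_trans => /(_ _ SB); rewrite ltxx.
Qed.

(* Each new index takes the color whose earlier members weigh least on it; the
   first [r.+1] indices take distinct colors, so that no class is empty. *)
Lemma greedy_coloring (K : numFieldType) (a : nat -> nat -> K) (r : nat)
    (B : K) :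
  (forall j k, 0 <= a j k) -> (forall j n, \sum_(k < n) a j k <= B) ->
  exists col : nat -> 'I_r.+1, (forall p : 'I_r.+1, col p = p) /\
    forall j, \sum_(k < j | col k == col j) a j k <= B / r.+1%:R.
Proof.
move=> a0 aB.
have B0 : 0 <= B by apply: le_trans (aB 0 0); rewrite big_ord0.
pose w (l : seq 'I_r.+1) p :=
  \sum_(k < size l | nth ord0 l k == p) a (size l) k.
(* The list [l] holds the colors given so far, so [size l] is the index to be colored next. *)
have /choice[F FE] (l : seq 'I_r.+1) : exists q : 'I_r.+1,
    if (size l < r.+1)%N then q = inord (size l) else w l q <= B / r.+1%:R.
  case: ltnP => _; first by eexists.
  apply: ex_le_mean => [p|]; first exact: sumr_ge0.
  apply: le_trans (aB (size l) (size l)).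
  by rewrite [leRHS](partition_big (fun k : 'I_ _ => nth ord0 l k) xpredT)//.
have [col colE] := course_of_values _ F.
have small j : (j < r.+1)%N -> col j = inord j.
  by move=> jr; have := FE (mkseq col j); rewrite -colE size_mkseq jr.
exists col; split=> [p|j]; first by rewrite small// inord_val.
have [jr|rj] := ltnP j r.+1.
  (* The first [r.+1] colors are distinct, so the sum is empty. *)
  rewrite big1 ?divr_ge0// => k /eqP/(congr1 val)/=.
  have kr := ltn_trans (ltn_ord k) jr.
  by rewrite !small// !inordK// => kj; have := ltn_ord k; rewrite kj ltnn.
have := FE (mkseq col j); rewrite -colE /w size_mkseq ltnNge rj/=.
by under eq_bigl => k do rewrite nth_mkseq//.
Qed.

(* Schur test for a strictly lower triangular kernel: by AM-GM,
   [2 x_j x_k <= t x_j^2 + x_k^2 / t]. *)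
Lemma triangular_form_le (K : numFieldType) (a : nat -> nat -> K)
    (x : nat -> K) (P : pred nat) (N : nat) (u v t : K) :
  (forall j k, 0 <= a j k) -> (forall j, 0 <= x j) -> 0 < t ->
  (forall j, P j -> \sum_(k < j | P k) a j k <= u) ->
  (forall k, \sum_(j < N) a j k <= v) ->
  2 * (\sum_(j < N | P j) \sum_(k < N | P k && (k < j)%N) a j k * (x j * x k))
    <= (t * u + v / t) * \sum_(j < N | P j) x j ^+ 2.
Proof.
move=> a0 x0 t0 au av; rewrite mulr_sumr mulrDl.
have amgm j k : 2 * (a j k * (x j * x k))
    <= t * x j ^+ 2 * a j k + x k ^+ 2 / t * a j k.
  rewrite -subr_ge0.
  have -> : t * x j ^+ 2 * a j k + x k ^+ 2 / t * a j k
      - 2 * (a j k * (x j * x k)) = a j k * (t * (x j - x k / t) ^+ 2).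
    by field; rewrite gt_eqF.
  have xr i : x i \is Num.real by rewrite realE x0.
  have tr : t^-1 \is Num.real by rewrite realE invr_ge0 ltW.
  rewrite mulr_ge0// mulr_ge0 ?(ltW t0)// real_exprn_even_ge0//.
  by rewrite rpredB// rpredM.
apply: (@le_trans _ _ (\sum_(j < N | P j) (t * x j ^+ 2 * u
    + \sum_(k < N | P k && (k < j)%N) x k ^+ 2 / t * a j k))).
  apply: ler_sum => j Pj; rewrite mulr_sumr.
  apply: le_trans (_ : _ <= \sum_(k < N | P k && (k < j)%N)
    (t * x j ^+ 2 * a j k + x k ^+ 2 / t * a j k)) _; first exact: ler_sum.
  rewrite big_split lerD2r -mulr_sumr ler_wpM2l//.
    by rewrite mulr_ge0 ?exprn_ge0// ltW.
  by rewrite -(big_ord_widen_cond N P (a j)) ?au// ltnW.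
rewrite big_split lerD//.
  rewrite -mulr_suml -mulr_sumr le_eqVlt; apply/orP; left; apply/eqP; ring.
(* Summing over [j] first turns the coefficient of [x k ^+ 2 / t] into part of a column sum, bounded
   by [v]. *)
rewrite (exchange_big_dep (fun k : 'I_N => P k)) /=;
  last by move=> j k _ /andP[].
rewrite mulr_sumr; apply: ler_sum => k Pk; rewrite -mulr_sumr.
rewrite -mulrA [v / t * _]mulrC ler_wpM2l ?exprn_ge0//.
rewrite [v / t]mulrC ler_wpM2l ?invr_ge0 ?(ltW t0)//.
apply: le_trans (av k); rewrite big_mkcond; apply: ler_sum => j _.
by case: ifP.
Qed.

(** The order of [K] may be partial, so the limit is first shown real, being below the real [B].
    Were it less than some [u n], all later terms would stay at distance at least [u n - limn u]
    from it. *)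
Lemma nondecreasing_real_cvgn_le (K : numFieldType) (u : nat -> K) (B : K) :
  {homo u : m n / (m <= n)%N >-> m <= n} -> (forall n, u n \is Num.real) ->
  B \is Num.real -> cvgn u -> limn u <= B -> forall n, u n <= B.
Proof.
move=> u_incr ur Br cu luB n; set l := limn u in luB.
have lr : l \is Num.real.
  by rewrite -[l](subrK B) -opprB rpredD// rpredN ger0_real// subr_ge0.
apply: le_trans luB; rewrite real_leNgt//; apply/negP => ltl.
have e0 : 0 < u n - l by rewrite subr_gt0.
have /cvgrPdist_lt/(_ _ e0)[M _ hM] : u @ \oo --> l := cu.
have := hM (maxn M n) (leq_maxl _ _) => /=.
have nm : u n <= u (maxn M n) by apply: u_incr; exact: leq_maxr.
rewrite distrC ger0_norm ?subr_ge0; last exact: le_trans (ltW ltl) nm.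
by rewrite ltrD2r => /lt_le_trans/(_ nm); rewrite ltxx.
Qed.

Lemma hilbert_scalars_norm (K : numFieldType) (theta : K -> K) :
  hilbert_scalars theta -> forall z, `|theta z| = `|z|.
Proof. by case=> R z //; rewrite norm_conjC. Qed.

Lemma hilbert_scalars_archi (K : numFieldType) (theta : K -> K) :
  hilbert_scalars theta -> forall x : K, 0 <= x -> exists n : nat, x <= n%:R.
Proof.
case=> R x x0; first by exists (Num.bound x); rewrite ltW// archi_boundP.
(* A nonnegative complex number is real, which reduces the claim to [R]. *)
have /complex_realP[k xE] : x \is Num.real by rewrite ger0_real.
move: x0; rewrite xE (lecR 0) => k0; exists (Num.bound k).
by rewrite -(rmorph_nat (@real_complex R)) lecR ltW// archi_boundP.
Qed.

Lemma fsum_ord (V : zmodType) (P : pred nat) (F : nat -> V) (N : nat) :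
  (forall k, P k -> (N <= k)%N -> F k = 0) ->
  \sum_(k \in [set k | P k]) F k = \sum_(k < N | P k) F k.
Proof.
move=> F0; rewrite -(big_mkord P) (@bigfs _ _ _ _ (index_iota 0 N)) ?iota_uniq// => k Pk.
by rewrite mem_index_iota -leqNgt; exact: F0.
Qed.

Section InnerProduct.
Variables (K : numFieldType) (theta : K -> K) (H : completeNormedModType K).
Variable dot : {dot H for theta}.
Hypothesis norm_theta : forall z, `|theta z| = `|z|.

Lemma norm_dotC (x y : H) : `|dot x y| = `|dot y x|.
Proof. by rewrite hermitian_subproof expr0 mul1r norm_theta. Qed.

Lemma norm_dotZ (b c : K) (x y : H) :
  `|dot (b *: x) (c *: y)| = `|dot x y| * (`|b| * `|c|).
Proof.
rewrite linearZl_LR linearr_subproof/= !normrM norm_theta.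
by rewrite mulrA mulrC.
Qed.

(** Expand the square into the double sum of [g j k]. Unit vectors put [|c j| ^+ 2] on the diagonal,
    and Hermitian symmetry gives both triangles the same bound, hence the factor 2. *)
Lemma gram_off_diagonal (f : nat -> H) (c : nat -> K) (P : pred nat) (N : nat) :
  inner_product dot -> (forall n, `|f n| = 1) ->
  `| `|\sum_(k < N | P k) c k *: f k| ^+ 2 - \sum_(k < N | P k) `|c k| ^+ 2 |
  <= 2 * \sum_(j < N | P j) \sum_(k < N | P k && (k < j)%N)
           `|dot (f j) (f k)| * (`|c j| * `|c k|).
Proof.
move=> hdot f1; pose g j k := dot (c j *: f j) (c k *: f k).
have gE j k : `|g j k| = `|dot (f j) (f k)| * (`|c j| * `|c k|).
  exact: norm_dotZ.
have gC j k : `|g j k| = `|g k j| by exact: norm_dotC.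
have gd j : g j j = `|c j| ^+ 2 by rewrite /g -hdot normrZ f1 mulr1.
have -> : `|\sum_(k < N | P k) c k *: f k| ^+ 2
    = \sum_(j < N | P j) \sum_(k < N | P k) g j k.
  rewrite hdot linear_sumlz; apply: eq_bigr => j _.
  by rewrite linear_sumr.
have -> : \sum_(j < N | P j) \sum_(k < N | P k) g j k
  - \sum_(k < N | P k) `|c k| ^+ 2 =
    \sum_(j < N | P j) \sum_(k < N | P k && (k < j)%N) g j k
  + \sum_(j < N | P j) \sum_(k < N | P k && (j < k)%N) g j k.
  rewrite -sumrB -big_split; apply: eq_bigr => j Pj /=.
  rewrite (bigD1 j)//= gd addrAC subrr add0r (bigID (fun k : 'I_N => (k < j)%N))/=.
  congr (_ + _); apply: eq_bigl => k; rewrite -andbA; congr (_ && _);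
    rewrite -val_eqE; case: ltngtP => //.
rewrite mulr2n mulrDl mul1r (le_trans (ler_normD _ _))// lerD//.
  rewrite (le_trans (ler_norm_sum _ _ _))// ler_sum// => j _.
  by rewrite (le_trans (ler_norm_sum _ _ _))// ler_sum// => k _; rewrite gE.
rewrite (exchange_big_dep (fun k : 'I_N => P k)) /=;
  last by move=> ? ? _ /andP[].
rewrite (le_trans (ler_norm_sum _ _ _))// ler_sum// => j Pj.
rewrite (le_trans (ler_norm_sum _ _ _))//.
by rewrite [leLHS]big_mkcond [leRHS]big_mkcond ler_sum// => k _; rewrite Pj gC gE.
Qed.

(** An off-diagonal part of at most half the diagonal gives the Riesz bounds [1 - 1/2] and
    [1 + 1/2]. *)
Lemma Riesz_sequence_of_gram (f : nat -> H) (P : pred nat) :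
  inner_product dot -> (forall n, `|f n| = 1) ->
  (forall (c : nat -> K) (N : nat),
    2 * (\sum_(j < N | P j) \sum_(k < N | P k && (k < j)%N)
      `|dot (f j) (f k)| * (`|c j| * `|c k|))
    <= 2^-1 * \sum_(j < N | P j) `|c j| ^+ 2) ->
  Riesz_sequence [set k | P k] f.
Proof.
move=> hdot f1 hP; exists 2^-1, (1 + 2^-1).
split=> [||c /finite_seqP[s sE]]; rewrite ?addr_gt0 ?invr_gt0//.
have [N hN] : exists N, forall k, P k -> (N <= k)%N -> c k = 0.
  (* One past the largest index of the support. *)
  exists (\max_(i <- s) i).+1 => k Pk; apply: contraTeq => ck.
  rewrite -leqNgt; apply: (@leq_bigmax_seq _ s xpredT id) => //.
  by have : [set` s] k by rewrite -sE.
rewrite !(@fsum_ord _ _ _ N); last 2 first.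
- by move=> k Pk Nk; rewrite (hN k)// scale0r.
- by move=> k Pk Nk; rewrite (hN k)// normr0 expr0n.
have := le_trans (gram_off_diagonal f c P N hdot f1) (hP c N).
set S := \sum_(k < N | _) `|c k| ^+ 2; set y := `|_| ^+ 2.
rewrite real_ler_norml; last by rewrite rpredB// ger0_real ?sumr_ge0 ?exprn_ge0.
rewrite lerBlDr lerBrDr => /andP[lo hi]; split.
  apply: le_trans lo; rewrite -subr_ge0.
  by have -> : - (2^-1 * S) + S - 2^-1 * S = 0 by field.
by rewrite mulrDl mul1r addrC.
Qed.

End InnerProduct.

(** The terms are nonnegative, so the bound on the limit passes to every partial sum. *)
Lemma Bessel_Schur_partial_sums (K : numFieldType) (theta : K -> K)
    (H : completeNormedModType K) (dot : {dot H for theta}) (f : nat -> H) :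
  Bessel_Schur dot f ->
  exists2 B : K, 0 < B & forall j n, \sum_(k < n) `|dot (f j) (f k)| <= B.
Proof.
move=> [B B0 hB]; exists B => // j n; have [cs lsB] := hB j.
rewrite -(big_mkord xpredT (fun k => `|dot (f j) (f k)|)).
apply: (nondecreasing_real_cvgn_le _ _ _ _ _ (gtr0_real B0) cs lsB).
- by apply/nondecreasing_seqP => m; rewrite seriesSr lerDl.
- by move=> m; rewrite ger0_real// sumr_ge0.
Qed.

Theorem theorem5 (K : numFieldType) (theta : K -> K)
  (hK : hilbert_scalars theta)
  (H : completeNormedModType K) (dot : {dot H for theta})
  (hdot : inner_product dot)
  (f : nat -> H) (hunit : forall n : nat, `|f n| = 1)
  (hBS : Bessel_Schur dot f) :
  exists (r : nat) (I : 'I_r -> set nat),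
    [/\ (1 <= r)%N,
        \bigcup_(p in [set: 'I_r]) I p = [set: nat],
        trivIset [set: 'I_r] I,
        (forall p : 'I_r, I p !=set0) &
        forall p : 'I_r, Riesz_sequence (I p) f].
Proof.
have norm_theta := hilbert_scalars_norm _ _ hK.
have [B B0 hB] := Bessel_Schur_partial_sums _ _ _ _ _ hBS.
have [r hr] : exists r : nat, 16 * B ^+ 2 <= r%:R.
  by apply: (hilbert_scalars_archi _ _ hK); rewrite mulr_ge0// exprn_ge0// ltW.
pose a j k := `|dot (f j) (f k)|.
have a0 j k : 0 <= a j k by exact: normr_ge0.
have [col [colp colB]] := greedy_coloring _ a r B a0 hB.
exists r.+1, (fun p => [set k | col k == p]); split=> //.
- by apply/seteqP; split=> // k _; exists (col k) => /=.
- by move=> p q _ _ [k [/eqP <- /eqP <-]].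
- by move=> p; exists p; rewrite /= colp.
move=> p; apply: (Riesz_sequence_of_gram _ _ _ _ norm_theta) => // c N.
(* With [t = 4 * B], [u = B / r.+1] and [v = B], the Schur factor [t * u + v / t] is at most
   [1/4 + 1/4]; the first term uses [16 * B ^+ 2 <= r]. *)
have t0 : 0 < 4 * B by rewrite mulr_gt0.
apply: le_trans (triangular_form_le _ a (fun k => `|c k|) (fun k => col k == p)
  N (B / r.+1%:R) B (4 * B) a0 _ t0 _ _) _.
- by move=> j; exact: normr_ge0.
- by move=> j /eqP <-; exact: colB.
(* By symmetry of [|dot|], column sums are row sums. *)
- by move=> k; under eq_bigr do rewrite /a norm_dotC//; exact: hB.
rewrite ler_wpM2r ?sumr_ge0//.
have -> : 2^-1 = 4^-1 + 4^-1 :> K by field.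
rewrite lerD//.
  rewrite mulrA ler_pdivrMr// -ler_pdivrMl ?invr_gt0// invrK.
  have -> : 4 * (4 * B * B) = 16 * B ^+ 2 by ring.
  by rewrite (le_trans hr)// ler_nat.
by have -> : B / (4 * B) = 4^-1 by field; rewrite gt_eqF.
Qed.
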